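(* Let $\pi$ be a policy, $\gamma\in[0,1)$, and $q^*$ a probability density on $\mathcal{S}\times\mathcal{A}$. Assume that $d^{\pi,\gamma}(\bar s,\bar a)$, $d^{\pi,\gamma}(\bar s,\bar a\mid s,a)$, $\tilde d^{\pi,\gamma}(\bar s,\bar a)$ and $q^*(\bar s,\bar a)$ are strictly positive densities on their common support and that $$L:=\sup_{(\bar s,\bar a)}\left|\log \frac{d^{\pi,\gamma}(\bar s,\bar a)}{q^*(\bar s,\bar a)}\right|<\infty .$$ Then $$\mathbb{E}_{(s,a)\sim d^{\pi,\gamma}(\cdot,\cdot)}\Big[-\mathrm{KL}_{\bar s,\bar a}\big(d^{\pi,\gamma}(\bar s,\bar a\mid s,a)\,\|\,q^*(\bar s,\bar a)\big)\Big]\le -\mathrm{KL}_{\bar s,\bar a}\big(d^{\pi,\gamma}(\bar s,\bar a)\,\|\,q^*(\bar s,\bar a)\big)+L\sqrt{2\,\mathrm{KL}_{\bar s,\bar a}\big(d^{\pi,\gamma}(\bar s,\bar a)\,\|\,\tilde d^{\pi,\gamma}(\bar s,\bar a)\big)}.$$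
   Context: Consider an infinite-horizon Markov decision process with state space $\mathcal{S}$, action space $\mathcal{A}$, initial state density $p_0$, transition density $p(s'\mid s,a)$, and discount factor $\gamma\in[0,1)$; a policy $\pi(a\mid s)$ is a conditional density over actions. (Densities are with respect to fixed reference measures, e.g. counting measure in the discrete case.) For $\Delta\ge 1$, $p^\pi_\Delta(\bar s\mid s,a)$ denotes the density of the state $s_\Delta$ when $s_0=s$, $a_0=a$, $a_t\sim\pi(\cdot\mid s_t)$ and $s_{t+1}\sim p(\cdot\mid s_t,a_t)$. The conditional state-action visitation distribution is $$d^{\pi,\gamma}(\bar s,\bar a\mid s,a)=(1-\gamma)\,\pi(\bar a\mid\bar s)\sum_{\Delta=1}^\infty\gamma^{\Delta-1}p^\pi_\Delta(\bar s\mid s,a).$$ The marginal (discounted) state-action visitation distribution is $d^{\pi,\gamma}(\bar s,\bar a)=(1-\gamma)\pi(\bar a\mid\bar s)\sum_{t=0}^\infty\gamma^t p^\pi_t(\bar s)$, where $p^\pi_t$ is the density of $s_t$ when $s_0\sim p_0$ and actions follow $\pi$. Finally $\tilde d^{\pi,\gamma}(\bar s,\bar a)=\mathbb{E}_{(s,a)\sim d^{\pi,\gamma}(\cdot,\cdot)}\big[d^{\pi,\gamma}(\bar s,\bar a\mid s,a)\big]$. $\mathrm{KL}$ denotes the Kullback–Leibler divergence. *)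

(* Defs.v *)
(* General measurable state/action spaces with
   sigma-finite reference measures; all densities are w.r.t. these
   reference measures (and their product on S * A). *)
From HB Require Import structures.
From mathcomp Require Import all_boot all_order all_algebra.
From mathcomp Require Import all_classical all_reals all_analysis.
Set Implicit Arguments. Unset Strict Implicit. Unset Printing Implicit Defensive.
Import Order.TTheory GRing.Theory Num.Theory.
Local Open Scope classical_set_scope.
Local Open Scope ring_scope.
Local Open Scope ereal_scope.

Section MDPDefs.
Context {d1 d2 : measure_display} {S : measurableType d1} {A : measurableType d2}
  {R : realType}.
Variables (muS : {sigma_finite_measure set S -> \bar R})
          (muA : {sigma_finite_measure set A -> \bar R}).

Definition muSA := (muS \x muA).

(* p^pi_{n+1}(sb | s, a): density of s_{n+1} given s_0 = s, a_0 = a *)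
Fixpoint ptrans (pi : S -> A -> R) (p : S -> A -> S -> R) (n : nat)
    (s : S) (a : A) (sb : S) : \bar R :=
  match n with
  | 0%N => (p s a sb)%:E
  | n'.+1 => \int[muSA]_z
       (ptrans pi p n' s a z.1 * (pi z.1 z.2 * p z.1 z.2 sb)%:E)
  end.

Fixpoint pmarg (p0 : S -> R) (pi : S -> A -> R) (p : S -> A -> S -> R)
    (t : nat) (sb : S) : \bar R :=
  match t with
  | 0%N => (p0 sb)%:E
  | t'.+1 => \int[muSA]_z
       (pmarg p0 pi p t' z.1 * (pi z.1 z.2 * p z.1 z.2 sb)%:E)
  end.

Definition dcond (pi : S -> A -> R) (p : S -> A -> S -> R) (gamma : R)
    (z : S * A) (zb : S * A) : \bar R :=
  ((1 - gamma) * pi zb.1 zb.2)%:E *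
  \sum_(0 <= n <oo) ((gamma ^+ n)%:E * ptrans pi p n z.1 z.2 zb.1).

Definition dmarg (p0 : S -> R) (pi : S -> A -> R) (p : S -> A -> S -> R)
    (gamma : R) (zb : S * A) : \bar R :=
  ((1 - gamma) * pi zb.1 zb.2)%:E *
  \sum_(0 <= t <oo) ((gamma ^+ t)%:E * pmarg p0 pi p t zb.1).

Definition dtilde (p0 : S -> R) (pi : S -> A -> R) (p : S -> A -> S -> R)
    (gamma : R) (zb : S * A) : \bar R :=
  \int[muSA]_z (dmarg p0 pi p gamma z * dcond pi p gamma z zb).

(* pointwise integrand of KL(f || g) with the usual conventions
   0 log(0/g) = 0 and f log(f/0) = +oo for f > 0 *)
Definition kl_integrand (fx gx : \bar R) : \bar R :=
  if fx == 0 then 0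
  else if gx == 0 then +oo
  else fx * (ln (fine fx / fine gx))%:E.

Definition KL (f g : S * A -> \bar R) : \bar R :=
  \int[muSA]_z kl_integrand (f z) (g z).

End MDPDefs.

Definition is_density {d} {T : measurableType d} {R : realType}
    (mu : {measure set T -> \bar R}) (f : T -> R) : Prop :=
  measurable_fun setT f /\ (forall x, 0 <= f x)%R /\
  (\int[mu]_x (f x)%:E = 1)%E.

(* Main.v *)
(* Write d for the marginal density, K(z, .) for the conditional one and dt for
   their mixture, and put g = ln (d / q), so |g| <= L.  Since
   KL(K z || q) = KL(K z || d) + E_{K z}[g] and KL(K z || d) >= 0, averaging over
   z ~ d bounds the left-hand side by - E_dt[g].  Now E_d[g] = KL(d || q) and
   E_d[g] - E_dt[g] <= L |d - dt|_1, and Pinsker's inequality concludes.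

   Pinsker's inequality is obtained by integrating a pointwise bound: for x, y > 0
   and every c, x ln (x / y) >= x - y + 3 c |x - y| - (3/2) c^2 (x + 2 y); then
   take c = |d - dt|_1 / 3.  For c = 0 this bound also gives KL(K z || d) >= 0.

   Densities may be +oo on a null set, which is handled by passing to their
   real parts. *)
Require Import Defs.
From HB Require Import structures.
From mathcomp Require Import all_boot all_order all_algebra.
From mathcomp Require Import all_classical all_reals all_analysis.
From mathcomp Require Import ring lra measurable_realfun.
Import Order.TTheory GRing.Theory Num.Theory.
Import numFieldNormedType.Exports.
Local Open Scope classical_set_scope.
Local Open Scope ring_scope.
Set Implicit Arguments. Unset Strict Implicit. Unset Printing Implicit Defensive.

(** * Monotone integration and the scalar logarithmic bounds *)

(* Unlike [le_integral] and [ge0_le_integral], no measurability is assumed, so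
   measurability of z |-> KL(K z || q) is never needed. *)
Lemma le_integral_pointwise (d : measure_display) (T : measurableType d)
    (R : realType) (mu : {measure set T -> \bar R}) (f g : T -> \bar R) :
  (forall x, (f x <= g x)%E) -> (\int[mu]_x f x <= \int[mu]_x g x)%E.
Proof.
move=> fg; rewrite /integral !patch_setT.
apply: leeB; apply: ereal_sup_le => _ [h hle <-]; exists h => //= x.
- by apply: le_trans (hle x) _; apply: (@funepos_le _ _ setT); rewrite ?inE.
- by apply: le_trans (hle x) _; apply: (@funeneg_le _ _ setT); rewrite ?inE.
Qed.

(* 3 (u - 1)^2 <= (2 u + 4) (u ln u - u + 1), divided by 2 u (u + 2) and split
   into partial fractions. *)
Lemma ln_lower_bound (R : realType) (u : R) : 0 < u ->
  5 / 2 <= ln u + 1 / 4 * u^-1 + 27 / 4 * (u + 2)^-1.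
Proof.
pose F (x : R) := ln x + 1 / 4 * x^-1 + 27 / 4 * (x + 2)^-1.
(* Over a common denominator the derivative of [F] has numerator [(x - 1) ^+ 3], so it has the sign
   of [x - 1] and [F] is minimal at 1, where it equals 5/2. The mean value theorem on each side of 1
   makes this precise. *)
pose F' (x : R) := (x - 1) ^+ 3 / (x ^+ 2 * (x + 2) ^+ 2).
have dF (x : R) : 0 < x -> is_derive x 1 F (F' x).
  move=> x0; have ? := is_derive1_ln x0.
  have x0' : x != 0 by rewrite gt_eqF.
  have x2' : x + 2 != 0 by rewrite gt_eqF// addr_gt0.
  have ? : is_derive x 1 (fun y : R => y^-1) (- x ^- 2 *: 1) by exact: is_deriveV.
  have ? : is_derive x 1 (fun y : R => (y + 2)^-1) (- (x + 2) ^- 2 *: (1 + 0)).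
    exact: is_deriveV.
  rewrite /F; apply: is_derive_eq.
  rewrite /F' /GRing.scale /=; field.
  by rewrite x0' x2'.
have cF (a b : R) : 0 < a -> {within `[a, b], continuous F}.
  move=> a0; apply: derivable_within_continuous => x.
  by rewrite in_itv/= => /andP[ax _]; have [] := dF x (lt_le_trans a0 ax).
have F1 : F 1 = 5 / 2 by rewrite /F ln1; field.
move=> u0; rewrite -/(F u) -F1.
have F'cube c : 0 < c -> 0 <= (c - 1) * F' c.
  move=> c0; rewrite mulrA -exprS divr_ge0//.
    by rewrite exprn_even_ge0.
  by rewrite mulr_ge0// sqr_ge0.
have [u1|u1|->] := ltgtP u 1; last by [].
- have [x|c] := MVT (df := F') u1 _ (cF _ _ u0).
    by rewrite in_itv/= => /andP[ux _]; apply: dF; exact: lt_trans ux.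
  rewrite in_itv/= => /andP[uc c1] FE.
  have := F'cube c (lt_trans u0 uc); nra.
- have [x|c] := MVT (df := F') u1 _ (cF _ _ ltr01).
    by rewrite in_itv/= => /andP[ux _]; apply: dF; exact: lt_trans ux.
  rewrite in_itv/= => /andP[c1 cu] FE.
  have := F'cube c (lt_trans ltr01 c1); nra.
Qed.

(** Taking [u = x / y] in [ln_lower_bound] and multiplying by [x] gives [x ln (x / y) >= x - y +
    (3/2) (x - y)^2 / (x + 2 y)]. The free [c] replaces the quotient by one of its tangents, affine
    in [|x - y|] and [x + 2 y], so that the bound can be integrated without Cauchy-Schwarz. *)
Lemma mul_ln_ratio_ge (R : realType) (x y c : R) : 0 < x -> 0 < y ->
  x - y + 3 * c * `|x - y| - 3 / 2 * c ^+ 2 * (x + 2 * y) <= x * ln (x / y).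
Proof.
move=> x0 y0; have := ln_lower_bound (divr_gt0 x0 y0).
rewrite -(ler_pM2l x0) => h.
rewrite -subr_ge0.
(* The interposed term is the completed square that accounts for replacing the quotient by its
   tangent. *)
apply: (@le_trans _ _
    (3 / 2 * (`|x - y| - c * (x + 2 * y)) ^+ 2 / (x + 2 * y))).
  apply: divr_ge0; last lra.
  by apply: mulr_ge0; [lra|exact: sqr_ge0].
move: h; set L := ln _; set a := `|x - y|.
have a2 : a ^+ 2 = (x - y) ^+ 2 by rewrite /a real_normK// num_real.
have : x * (L + 1 / 4 * (x / y)^-1 + 27 / 4 * (x / y + 2)^-1) =
   x * L + y / 4 + 27 / 4 * x * y / (x + 2 * y).
  by field; rewrite !gt_eqF ?addr_gt0 ?mulr_gt0.
move=> -> h.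
have -> : 3 / 2 * (a - c * (x + 2 * y)) ^+ 2 / (x + 2 * y) =
  3 / 2 * (a ^+ 2 / (x + 2 * y)) - 3 * c * a + 3 / 2 * c ^+ 2 * (x + 2 * y).
  by field; rewrite !gt_eqF ?addr_gt0 ?mulr_gt0.
rewrite a2.
have : 3 / 2 * ((x - y) ^+ 2 / (x + 2 * y)) =
  5 / 2 * x - (x - y) - y / 4 - 27 / 4 * x * y / (x + 2 * y).
  by field; rewrite !gt_eqF ?addr_gt0 ?mulr_gt0.
lra.
Qed.

(** * Sigma-finiteness of product measures *)

Section prod_sigma_finite.
Context {d1 d2 : measure_display} {T1 : measurableType d1}
  {T2 : measurableType d2} {R : realType}.
Variables (m1 : {sigma_finite_measure set T1 -> \bar R})
  (m2 : {sigma_finite_measure set T2 -> \bar R}).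

(* A copy of the product measure: on [\x] itself, the library's sigma-finite
   canonical instance is only found for products of subprobabilities. *)
Definition prod_sf : set (T1 * T2) -> \bar R := (m1 \x m2)%E.

HB.instance Definition _ := Measure.on prod_sf.

(** Rectangles with equal indices already cover, because both exhausting sequences are
    nondecreasing. *)
Lemma prod_sf_sigma_finite : sigma_finite setT prod_sf.
Proof.
have /sigma_finiteP[F [coverF ndF finF]] := sigma_finiteT m1.
have /sigma_finiteP[G [coverG ndG finG]] := sigma_finiteT m2.
exists (fun n => F n `*` G n) => [|n].
  rewrite predeqE => -[x y]; split=> // _.
  have [i _ Fix] : (\bigcup_i F i) x by rewrite -coverF.
  have [j _ Gjy] : (\bigcup_j G j) y by rewrite -coverG.
  exists (maxn i j) => //; split.
  - by move: Fix; apply/subsetPset/ndF/leq_maxl.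
  - by move: Gjy; apply/subsetPset/ndG/leq_maxr.
have [mF Foo] := finF n; have [mG Goo] := finG n.
split; first exact: measurableX.
by rewrite [ltLHS]product_measure1E// lte_mul_pinfty// ge0_fin_numE.
Qed.

HB.instance Definition _ :=
  Measure_isSigmaFinite.Build _ _ _ prod_sf prod_sf_sigma_finite.

End prod_sigma_finite.

(** * Density kernels and their composition *)

Section density_kernel.
Local Open Scope ereal_scope.
Context {R : realType}.

(** Values are extended because densities built from integrals and series may be infinite on a null
    set. Joint measurability is what Tonelli requires. A single density is encoded as a kernel with
    source [unit]. *)
Definition is_density_kernel {d d' : measure_display} {T : measurableType d}
    {U : measurableType d'} (mu : set U -> \bar R) (K : T -> U -> \bar R) :=
  [/\ measurable_fun setT (fun z : T * U => K z.1 z.2),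
      forall t u, 0 <= K t u &
      forall t, \int[mu]_u K t u = 1].

(** Tonelli puts the integral of [Q u] innermost, where it is 1. This serves both the transition
    step of the process and the mixture of conditional visitation densities. *)
Lemma density_kernel_comp {d d' d'' : measure_display} {T : measurableType d}
    {U : measurableType d'} {V : measurableType d''}
    (mu : {sigma_finite_measure set U -> \bar R})
    (nu : {sigma_finite_measure set V -> \bar R})
    (K : T -> U -> \bar R) (Q : U -> V -> \bar R) :
  is_density_kernel mu K -> is_density_kernel nu Q ->
  is_density_kernel nu (fun t v => \int[mu]_u (K t u * Q u v)).
Proof.
move=> [mK K0 K1] [mQ Q0 Q1].
have mKQ : measurable_fun [set: T * V * U]
    (fun w => K w.1.1 w.2 * Q w.2 w.1.2).
  apply: emeasurable_funM.
    apply: (@measurableT_comp _ _ _ _ _ _ (fun z : T * U => K z.1 z.2) _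
      (fun w : T * V * U => (w.1.1, w.2))) => //.
    by apply: measurable_fun_pair => //; exact: measurableT_comp.
  apply: (@measurableT_comp _ _ _ _ _ _ (fun z : U * V => Q z.1 z.2) _
    (fun w : T * V * U => (w.2, w.1.2))) => //.
  by apply: measurable_fun_pair => //; exact: measurableT_comp.
split=> [|t v|t].
- apply: (measurable_fun_fubini_tonelli_F (m2 := mu)
    (fun w : T * V * U => K w.1.1 w.2 * Q w.2 w.1.2)) => // w.
  exact: mule_ge0.
- by apply: integral_ge0 => u _; exact: mule_ge0.
- transitivity (\int[mu]_u \int[nu]_v (K t u * Q u v)).
    have := fubini_tonelli (m1 := nu) (m2 := mu)
      (fun w : V * U => K t w.2 * Q w.2 w.1).
    apply => [|w]; last exact: mule_ge0.
    apply: (@measurableT_comp _ _ _ _ _ _ (fun w : T * V * U => _) _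
      (fun w : V * U => (t, w.1, w.2)) mKQ).
    by do 2 apply: measurable_fun_pair => //.
  rewrite -[RHS](K1 t); apply: eq_integral => u _.
  rewrite ge0_integralZl ?Q1 ?mule1//.
  by apply: (@measurableT_comp _ _ _ _ _ _ (fun z : U * V => Q z.1 z.2) _
    (pair u)) => //.
Qed.

End density_kernel.

(** * KL integrands of real parts, and Pinsker's inequality *)

Lemma kl_integrand_EFin (R : realType) (x y : R) : 0 <= x -> 0 <= y ->
  (0 < x) = (0 < y) -> kl_integrand x%:E y%:E = (x * ln (x / y))%:E.
Proof.
rewrite !le0r /kl_integrand !eqe => /orP[/eqP->|x0] /orP[/eqP->|y0].
- by rewrite eqxx mul0r.
- by rewrite ltxx y0.
- by rewrite ltxx x0.
- by rewrite !gt_eqF// EFinM.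
Qed.

(** Since [fine] sends [+oo] to 0, the left side vanishes as soon as an argument is infinite, and
    the right side is then 0 or [+oo]. Equality fails at [x = +oo], [y = 0]. *)
Lemma le_kl_integrand_fine (R : realType) (x y : \bar R) :
  (0 <= x)%E -> (0 <= y)%E -> (0 < x < +oo)%E = (0 < y < +oo)%E ->
  (kl_integrand (fine x)%:E (fine y)%:E <= kl_integrand x y)%E.
Proof.
case: x => [x| |]//; case: y => [y| |]//; rewrite /kl_integrand /= ?lee_fin.
- move=> x0 _; rewrite ltry andbT lte_fin ltxx andbF.
  by move: x0; rewrite le0r => /orP[/eqP->|->]//; rewrite !eqxx.
- by move=> _ _ _; rewrite eqxx; case: ifP => _; rewrite ?leey// mul0r ln0.
- by rewrite !eqxx invr0 mulr0 ln0// mule0.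
Qed.

Section density.
Context {d : measure_display} {T : measurableType d} {R : realType}.
Variable mu : {measure set T -> \bar R}.
Implicit Types f g : T -> R.

Lemma integrable_density f : is_density mu f ->
  mu.-integrable setT (EFin \o f).
Proof.
move=> [mf [f0 f1]]; apply/integrableP; split; first exact/measurable_EFinP.
under eq_integral do rewrite /= ger0_norm//.
by rewrite f1 ltry.
Qed.

Lemma integrable_densityM f g (M : R) : is_density mu f ->
  measurable_fun setT g -> (forall x, `|g x| <= M) ->
  mu.-integrable setT (EFin \o (fun x => f x * g x)).
Proof.
move=> df mg gM.
have := integrableMl measurableT (integrable_density df) mg.
apply; exists M; split; first exact: num_real.
by move=> N MN x _; apply: le_trans (gM x) (ltW MN).
Qed.

Lemma EFin_Rintegral f : mu.-integrable setT (EFin \o f) ->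
  (\int[mu]_x f x)%:E = (\int[mu]_x (f x)%:E)%E.
Proof. by move=> fi; rewrite fineK//; exact: integrable_fin_num. Qed.

Lemma Rintegral_density f : is_density mu f -> \int[mu]_x f x = 1.
Proof.
move=> df; apply: EFin_inj; rewrite EFin_Rintegral ?df.2.2//.
exact: integrable_density.
Qed.

Lemma pinsker f g : is_density mu f -> is_density mu g ->
  (forall x, (0 < f x) = (0 < g x)) ->
  (((\int[mu]_x `|f x - g x|) ^+ 2)%:E <=
   2%:E * \int[mu]_x kl_integrand (f x)%:E (g x)%:E)%E.
Proof.
move=> df dg fg0.
have fi := integrable_density df; have gi := integrable_density dg.
have f1 := Rintegral_density df; have g1 := Rintegral_density dg.
have fgi : mu.-integrable setT (EFin \o (fun x => f x - g x)).
  exact: (integrableB measurableT fi gi).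
have afgi : mu.-integrable setT (EFin \o (fun x => `|f x - g x|)).
  exact: integrable_norm.
set V := \int[mu]_x _.
have V0 : 0 <= V by exact: Rintegral_ge0.
(* As [f] and [g] have integral 1, the pointwise bound integrates to [3 c V - (9/2) c^2], which is
   maximal at this [c], with value [V^2 / 2]. *)
pose c := V / 3.
have i1 : mu.-integrable setT (EFin \o (fun x => (3 * c) * `|f x - g x|)).
  exact: (integrableZl measurableT (3 * c) afgi).
have i2 : mu.-integrable setT (EFin \o (fun x => 2 * g x)).
  exact: (integrableZl measurableT 2 gi).
have i3 : mu.-integrable setT (EFin \o (fun x => f x + 2 * g x)).
  exact: (integrableD measurableT fi i2).
have i4 : mu.-integrable setT
    (EFin \o (fun x => 3 / 2 * c ^+ 2 * (f x + 2 * g x))).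
  exact: (integrableZl measurableT (3 / 2 * c ^+ 2) i3).
have i5 : mu.-integrable setT
    (EFin \o (fun x => f x - g x + 3 * c * `|f x - g x|)).
  exact: (integrableD measurableT fgi i1).
have i6 : mu.-integrable setT
    (EFin \o (fun x => f x - g x + 3 * c * `|f x - g x| -
                       3 / 2 * c ^+ 2 * (f x + 2 * g x))).
  exact: (integrableB measurableT i5 i4).
have VE : \int[mu]_x (f x - g x + 3 * c * `|f x - g x| -
                       3 / 2 * c ^+ 2 * (f x + 2 * g x)) = V ^+ 2 / 2.
  rewrite RintegralB// RintegralD// RintegralB// !RintegralZl// RintegralD//.
  by rewrite RintegralZl// f1 g1 -/V /c; field.
rewrite [V ^+ 2](_ : _ = 2 * (V ^+ 2 / 2)); last by field.
rewrite EFinM lee_wpmul2l ?lee_fin// -VE EFin_Rintegral//.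
apply: le_integral_pointwise => x.
have [mf [f0 _]] := df; have [mg [g0 _]] := dg.
rewrite kl_integrand_EFin// lee_fin.
have := f0 x; have := fg0 x; rewrite le0r => + /orP[/eqP fx0|fx].
  rewrite fx0 ltxx => /esym/negbT; rewrite -leNgt => gx0.
  have -> : g x = 0 by apply: le_anti; rewrite gx0 g0.
  by rewrite subr0 normr0 !mulr0 mul0r !addr0 mulr0 subr0.
by rewrite fx => /esym gx; exact: mul_ln_ratio_ge.
Qed.

End density.

(** * Real parts, geometric mixtures and products of density kernels *)

Section density_kernel_theory.
Local Open Scope ereal_scope.
Context {R : realType} {d d' : measure_display} {T : measurableType d}
  {U : measurableType d'}.

Lemma measurable_density_kernel (mu : set U -> \bar R) (K : T -> U -> \bar R)
    (t : T) :
  is_density_kernel mu K -> measurable_fun setT (K t).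
Proof.
move=> [mK _ _].
by apply: (@measurableT_comp _ _ _ _ _ _ (fun z : T * U => K z.1 z.2) _
  (pair t)).
Qed.

(** Total mass 1 makes [K t] integrable, hence finite almost everywhere, so passing to real parts
    changes no integral. *)
Lemma density_kernel_fine (mu : {measure set U -> \bar R})
    (K : T -> U -> \bar R) (t : T) :
  is_density_kernel mu K ->
  is_density mu (fine \o K t) /\
  ae_eq mu setT (K t) (EFin \o (fine \o K t)).
Proof.
move=> dK; have mK := measurable_density_kernel t dK.
have [_ K0 K1] := dK.
have Ki : mu.-integrable setT (K t).
  apply/integrableP; split=> //.
  by under eq_integral do rewrite gee0_abs//; rewrite K1 ltry.
have aeK : ae_eq mu setT (K t) (EFin \o (fine \o K t)).
  apply: filterS (integrable_ae measurableT Ki) => u Ktu _ /=.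
  by rewrite fineK//; exact: Ktu.
have mfK : measurable_fun setT (fine \o K t) by exact: measurableT_comp.
split=> //; split=> //; split; first by move=> u; exact: fine_ge0.
rewrite -(K1 t); apply/esym/ae_eq_integral => //.
exact/measurable_EFinP.
Qed.

(** The weights [(1 - gamma) * gamma ^+ n] sum to 1, and nonnegativity lets the series and the
    integral be exchanged. *)
Lemma density_kernel_geometric (mu : {measure set U -> \bar R}) (gamma : R)
    (K : nat -> T -> U -> \bar R) : (0 <= gamma < 1)%R ->
  (forall n, is_density_kernel mu (K n)) ->
  is_density_kernel mu (fun t u => (1 - gamma)%:E *
    \sum_(0 <= n <oo) ((gamma ^+ n)%:E * K n t u)).
Proof.
move=> /andP[g0 g1] dK.
have g1' : (0 <= 1 - gamma)%R by rewrite subr_ge0 ltW.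
have gK0 n t u : 0 <= (gamma ^+ n)%:E * K n t u.
  by rewrite mule_ge0 ?lee_fin ?exprn_ge0//; have [] := dK n.
have S0 t u : 0 <= \sum_(0 <= n <oo) ((gamma ^+ n)%:E * K n t u).
  by apply: nneseries_ge0 => n _ _; exact: gK0.
have mgK n t : measurable_fun setT (fun u => (gamma ^+ n)%:E * K n t u).
  by apply: measurable_funeM; exact: measurable_density_kernel (dK n).
split=> [|t u|t].
- apply: measurable_funeM.
  apply: ge0_emeasurable_sum => // n _.
  by apply: measurable_funeM; have [] := dK n.
- by rewrite mule_ge0.
- rewrite ge0_integralZl//; last first.
    by apply: ge0_emeasurable_sum => //.
  rewrite integral_nneseries//.
  have -> : \sum_(0 <= n <oo) \int[mu]_u ((gamma ^+ n)%:E * K n t u) =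
      ((1 - gamma)^-1)%:E.
    transitivity (\sum_(0 <= n <oo) (gamma ^+ n)%:E).
      apply: eq_eseriesr => n _; have [_ K0 K1] := dK n.
      rewrite ge0_integralZl ?lee_fin ?exprn_ge0// ?K1 ?mule1//.
      exact: measurable_density_kernel (dK n).
    apply/cvg_lim => //.
    have g1n : (`|gamma| < 1)%R by rewrite ger0_norm.
    have := cvg_geometric_series (a := 1%R) g1n; rewrite mul1r => gcvg.
    rewrite (_ : (fun n => _) = EFin \o series (geometric 1%R gamma)).
      apply: cvg_EFin => //; exact: nearW.
    apply/funext => n /=; rewrite /series/= -sumEFin big_mkord.
    by rewrite big_mkord; apply: eq_bigr => i _; rewrite mul1r.
  by rewrite -EFinM divff// gt_eqF// subr_gt0.
Qed.

Lemma density_kernel_prod {d'' : measure_display} {V : measurableType d''}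
    (mu : {sigma_finite_measure set U -> \bar R})
    (nu : {sigma_finite_measure set V -> \bar R})
    (K : T -> U -> \bar R) (p : U -> V -> R) :
  is_density_kernel mu K ->
  measurable_fun setT (fun z : U * V => p z.1 z.2) ->
  (forall u, is_density nu (p u)) ->
  is_density_kernel (prod_sf mu nu) (fun t z => K t z.1 * (p z.1 z.2)%:E).
Proof.
move=> dK mp dp; have [mK K0 K1] := dK.
have Kp0 t (z : U * V) : 0 <= K t z.1 * (p z.1 z.2)%:E.
  by rewrite mule_ge0// lee_fin; have [_ [+ _]] := dp z.1; exact.
have mKp : measurable_fun [set: T * (U * V)]
    (fun w => K w.1 w.2.1 * (p w.2.1 w.2.2)%:E).
  apply: emeasurable_funM.
    apply: (@measurableT_comp _ _ _ _ _ _ (fun z : T * U => K z.1 z.2) _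
      (fun w : T * (U * V) => (w.1, w.2.1))) => //.
    by apply: measurable_fun_pair => //; exact: measurableT_comp.
  apply/measurable_EFinP.
  apply: (@measurableT_comp _ _ _ _ _ _ (fun z : U * V => p z.1 z.2) _
    (fun w : T * (U * V) => w.2)); [exact: mp|exact: measurable_snd].
split=> // t.
rewrite [LHS](fubini_tonelli1 (fun z : U * V => K t z.1 * (p z.1 z.2)%:E))//.
  rewrite -[RHS](K1 t); apply: eq_integral => u _.
  have [mpu [pu0 pu1]] := dp u.
  rewrite /fubini_F /= ge0_integralZl ?pu1 ?mule1//.
    exact/measurable_EFinP.
  by move=> v _; rewrite lee_fin.
by apply: (@measurableT_comp _ _ _ _ _ _ (fun w : T * (U * V) => _) _
  (pair t) mKp).
Qed.

End density_kernel_theory.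

(** * Conventions at zero and infinity *)

Lemma ln_div (R : realType) (x y : R) : 0 <= x -> 0 <= y ->
  (0 < x) = (0 < y) -> ln (x / y) = ln x - ln y.
Proof.
rewrite !le0r => /orP[/eqP->|x0] /orP[/eqP->|y0].
- by rewrite mul0r ln0// subrr.
- by rewrite ltxx y0.
- by rewrite ltxx x0.
- by rewrite lnM ?posrE ?invr_gt0// lnV.
Qed.

(** Turns the support conditions on extended densities into positivity of their real parts. *)
Lemma fine_gt0_lty (R : realType) (x : \bar R) :
  (0 <= x)%E -> (0 < fine x) = (0 < x < +oo)%E.
Proof.
case: x => [x| |]//= _; first by rewrite lte_fin ltry andbT.
by rewrite !ltxx andbF.
Qed.

Lemma fine_le_EFin (R : realType) (x : \bar R) :
  (0 <= x)%E -> ((fine x)%:E <= x)%E.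
Proof. by case: x. Qed.

(** * The KL inequality for a general density, kernel and reference density *)

Section kl_mixture.
Context {dZ : measure_display} {Z : measurableType dZ} {R : realType}.
Variable mu : {sigma_finite_measure set Z -> \bar R}.
Variables (f : Z -> \bar R) (K : Z -> Z -> \bar R) (q : Z -> R) (X : set Z).
Variable l : R.

Let mix zb := (\int[mu]_z (f z * K z zb))%E.
Let kl (g h : Z -> \bar R) := (\int[mu]_z kl_integrand (g z) (h z))%E.

Hypothesis df : is_density_kernel mu (fun _ : unit => f).
Hypothesis dK : is_density_kernel mu K.
Hypothesis dq : is_density mu q.
Hypothesis fX : forall z, (z \in X) = (0 < f z < +oo)%E.
Hypothesis mixX : forall z, (z \in X) = (0 < mix z < +oo)%E.
Hypothesis qX : forall z, (z \in X) = (0 < q z).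
Hypothesis KX : forall z zb, (zb \in X) = (0 < K z zb < +oo)%E.
Hypothesis lX : forall z, z \in X -> `|ln (fine (f z) / q z)| <= l.
Hypothesis l0 : 0 <= l.

Let rf z := fine (f z).
Let rmix z := fine (mix z).
Let rK z zb := fine (K z zb).
(* Off X this is [ln (0 / 0) = ln 0 = 0]. *)
Let G z := ln (rf z / q z).
(* A shift of -G making the integrand nonnegative, so that Tonelli applies. *)
Let W z := l - G z.

Let mf : measurable_fun setT f.
Proof. exact: (measurable_density_kernel tt df). Qed.
Let f0 z : (0 <= f z)%E. Proof. by have [_ + _] := df; exact. Qed.
Let drf : is_density mu rf.
Proof. by have [] := density_kernel_fine tt df. Qed.
Let aef : ae_eq mu setT f (EFin \o rf).
Proof. by have [] := density_kernel_fine tt df. Qed.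
Let dmix : is_density_kernel mu (fun _ : unit => mix).
Proof. exact: density_kernel_comp df dK. Qed.
Let drmix : is_density mu rmix.
Proof. by have [] := density_kernel_fine tt dmix. Qed.
Let aemix : ae_eq mu setT mix (EFin \o rmix).
Proof. by have [] := density_kernel_fine tt dmix. Qed.
Let drK z : is_density mu (rK z).
Proof. by have [] := density_kernel_fine z dK. Qed.
Let K0 z zb : (0 <= K z zb)%E. Proof. by have [_ + _] := dK; exact. Qed.
Let q0 z : 0 <= q z. Proof. by have [_ [+ _]] := dq; exact. Qed.
Let mix0 z : (0 <= mix z)%E. Proof. by have [_ + _] := dmix; exact. Qed.
Let rf0 z : 0 <= rf z. Proof. exact: fine_ge0. Qed.
Let rK0 z zb : 0 <= rK z zb. Proof. exact: fine_ge0. Qed.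

Let rfX z : (z \in X) = (0 < rf z). Proof. by rewrite fX fine_gt0_lty//. Qed.
Let rKX z zb : (zb \in X) = (0 < rK z zb).
Proof. by rewrite (KX z) fine_gt0_lty//. Qed.
Let rmixX z : (z \in X) = (0 < rmix z). Proof. by rewrite mixX fine_gt0_lty//. Qed.

Let notinX0 z (x : R) : 0 <= x -> (z \in X) = (0 < x) -> z \notin X -> x = 0.
Proof.
by move=> x0 -> ; rewrite -leNgt => xle0; apply: le_anti; rewrite xle0.
Qed.

Let GE z : G z = ln (rf z) - ln (q z).
Proof. by rewrite /G ln_div// -rfX. Qed.

Let mG : measurable_fun setT G.
Proof.
rewrite (funext GE); apply: measurable_funB.
  by apply: measurableT_comp drf.1; exact: measurable_ln.
by apply: measurableT_comp dq.1; exact: measurable_ln.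
Qed.

Let Gl z : `|G z| <= l.
Proof.
have [zX|zX] := boolP (z \in X); first exact: lX.
by rewrite /G (notinX0 (q0 z) (qX z) zX) invr0 mulr0 ln0// normr0.
Qed.

Let mW : measurable_fun setT W. Proof. exact: measurable_funB. Qed.

Let W0 z : 0 <= W z.
Proof. by rewrite subr_ge0; have := Gl z; rewrite ler_norml => /andP[]. Qed.

Let W2l z : W z <= 2 * l.
Proof. by have := Gl z; rewrite ler_norml /W => /andP[]; lra. Qed.

Let Wl z : `|W z| <= 2 * l. Proof. by rewrite ger0_norm. Qed.

(** This is [l] minus the mean of [G] under [K z]. It is measurable in [z] and bounded, and it
    stands in for the conditional KL divergence in the outer integral. *)
Let J z := (\int[mu]_zb (K z zb * (W zb)%:E))%E.

Let mKW z : measurable_fun setT (fun zb => K z zb * (W zb)%:E)%E.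
Proof.
apply: emeasurable_funM; first exact: measurable_density_kernel dK.
exact/measurable_EFinP.
Qed.

Let J0 z : (0 <= J z)%E.
Proof. by apply: integral_ge0 => zb _; rewrite mule_ge0// lee_fin. Qed.

Let J2l z : (J z <= (2 * l)%:E)%E.
Proof.
have [_ _ K1] := dK.
have mKz := measurable_density_kernel z dK.
rewrite -[leRHS]mul1e -(K1 z) -ge0_integralZr ?lee_fin ?mulr_ge0//.
by apply: le_integral_pointwise => zb; rewrite lee_wpmul2l// lee_fin.
Qed.

Let integrable_W g : is_density mu g ->
  mu.-integrable setT (EFin \o (fun z => g z * W z)).
Proof. by move=> dg; apply: integrable_densityM dg mW Wl. Qed.

(** On [X], with [r = rK z zb], the integrand [r ln (r / q)] is [r ln (r / rf) + r G], and the case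
    [c = 0] of [mul_ln_ratio_ge] bounds it below by [r - rf + r (l - W)]. This minorant is
    integrable, with integral [l] minus the mean of [W]. *)
Let kl_cond_le z : (- kl (K z) (fun zb => (q zb)%:E) <= J z - l%:E)%E.
Proof.
have rKi := integrable_density (drK z); have rfi := integrable_density drf.
have rKWi := integrable_W (drK z).
have lrKi : mu.-integrable setT (EFin \o (fun zb => (l + 1) * rK z zb)).
  exact: (integrableZl measurableT (l + 1) rKi).
have i1 : mu.-integrable setT
    (EFin \o (fun zb => (l + 1) * rK z zb - rK z zb * W zb)).
  exact: (integrableB measurableT lrKi rKWi).
have i2 : mu.-integrable setT
    (EFin \o (fun zb => (l + 1) * rK z zb - rK z zb * W zb - rf zb)).
  exact: (integrableB measurableT i1 rfi).
have IE : \int[mu]_zb ((l + 1) * rK z zb - rK z zb * W zb - rf zb) =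
    l - \int[mu]_zb (rK z zb * W zb).
  rewrite RintegralB// RintegralB// RintegralZl//.
  by rewrite (Rintegral_density (drK z)) (Rintegral_density drf); ring.
rewrite leeNl oppeB; last by rewrite fin_num_adde_defl.
(* Replacing [K z] by its real part can only lower the integral against [W >= 0], which is the
   direction needed. *)
apply: (@le_trans _ _ (- (\int[mu]_zb (rK z zb * W zb)%:E) + l%:E)%E).
  apply: leeD2r; rewrite leeN2.
  apply: le_integral_pointwise => zb; rewrite EFinM lee_wpmul2r ?lee_fin//.
  exact: fine_le_EFin.
rewrite -EFin_Rintegral// -EFinN -EFinD addrC -IE EFin_Rintegral//.
apply: le_integral_pointwise => zb.
apply: (@le_trans _ _ (kl_integrand (rK z zb)%:E (q zb)%:E)).
  rewrite kl_integrand_EFin// -?rKX// lee_fin.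
  have [zbX|zbX] := boolP (zb \in X); last first.
    by rewrite (notinX0 (rK0 z zb) (rKX z zb) zbX)
      (notinX0 (rf0 zb) (rfX zb) zbX) !(mul0r, mulr0) !subr0.
  have rKp : 0 < rK z zb by rewrite -rKX.
  have rfp : 0 < rf zb by rewrite -rfX.
  have qp : 0 < q zb by rewrite -qX.
  have := mul_ln_ratio_ge 0 rKp rfp.
  have WE : W zb = l - (ln (rf zb) - ln (q zb)) by rewrite -GE.
  rewrite WE !ln_div ?rKp ?rfp ?qp// expr0n/= !(mulr0, mul0r) addr0 subr0.
  rewrite -subr_ge0 -[_ <= rK z zb * _]subr_ge0 => h.
  by apply: le_trans h _; rewrite le_eqVlt; apply/orP; left; apply/eqP; ring.
have -> : (q zb)%:E = (fine (q zb)%:E)%:E :> \bar R by [].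
by apply: le_kl_integrand_fine; rewrite ?lee_fin// -KX qX lte_fin ltry andbT.
Qed.

(** Here equality holds: almost everywhere the integrand is [rf * G], which is integrable because
    [G] is bounded. Substituting [G = l - W] gives the stated form. *)
Let kl_marg : (- kl f (fun z => (q z)%:E) =
  (\int[mu]_z (rf z * W z) - l)%:E)%E.
Proof.
have rfi := integrable_density drf; have rfWi := integrable_W drf.
have rfGi : mu.-integrable setT (EFin \o (fun z => rf z * G z)).
  exact: integrable_densityM drf mG Gl.
have lrfi : mu.-integrable setT (EFin \o (fun z => l * rf z)).
  exact: (integrableZl measurableT l rfi).
have -> : \int[mu]_z (rf z * W z) = l - \int[mu]_z (rf z * G z).
  under eq_Rintegral do rewrite mulrBr mulrC.
  by rewrite RintegralB// RintegralZl// (Rintegral_density drf) mulr1.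
rewrite addrAC subrr add0r EFinN; congr (- _)%E.
rewrite EFin_Rintegral//.
apply: ae_eq_integral => //.
(* Unfolding [G] inside the last branch makes the measurability of the KL integrand visible. *)
- rewrite (_ : (fun z => _) = (fun z => if f z == 0 then 0 else
    if (q z)%:E == 0 then +oo else f z * (G z)%:E)%E)//.
  apply: measurable_fun_ifT => //; first exact: measurable_fun_eqe.
  apply: measurable_fun_ifT => //.
    apply: measurable_fun_eqe => //.
    by apply/measurable_EFinP; have [] := dq.
  by apply: emeasurable_funM => //; exact/measurable_EFinP.
- by have [] := integrableP _ _ _ rfGi.
- apply: filterS aef => z fz _; rewrite fz// /= kl_integrand_EFin//.
  by rewrite -rfX.
Qed.

Lemma kl_mixture_le :
  (\int[mu]_z (f z * - kl (K z) (fun zb => (q zb)%:E)) <=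
   - kl f (fun z => (q z)%:E) + l%:E * sqrte (2%:E * kl f mix))%E.
Proof.
have rfi := integrable_density drf; have rmi := integrable_density drmix.
have rfWi := integrable_W drf; have rmWi := integrable_W drmix.
have mKW2 : measurable_fun [set: Z * Z] (fun w => K w.1 w.2 * (W w.2)%:E)%E.
  apply: emeasurable_funM; first by have [] := dK.
  by apply/measurable_EFinP; exact: measurableT_comp.
have mJ : measurable_fun setT J.
  apply: (measurable_fun_fubini_tonelli_F (m2 := mu)
    (fun w : Z * Z => K w.1 w.2 * (W w.2)%:E)%E) => // w.
  by rewrite mule_ge0// lee_fin.
have Jfin z : J z \is a fin_num.
  by rewrite ge0_fin_numE// (le_lt_trans (J2l z))// ltry.
pose j z := fine (J z).
have jE z : (j z)%:E = J z by rewrite /j fineK.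
have jl z : `|j z| <= 2 * l.
  by rewrite ger0_norm -?lee_fin jE.
have mj : measurable_fun setT j by exact: measurableT_comp.
have rfji : mu.-integrable setT (EFin \o (fun z => rf z * j z)).
  exact: integrable_densityM drf mj jl.
have lrfi : mu.-integrable setT (EFin \o (fun z => l * rf z)).
  exact: (integrableZl measurableT l rfi).
have fJE : (\int[mu]_z (f z * (J z - l%:E)) =
    (\int[mu]_z (rf z * j z) - l)%:E)%E.
  transitivity (\int[mu]_z (rf z * j z - l * rf z)%:E)%E.
    apply: ae_eq_integral => //.
    - apply: emeasurable_funM => //; exact: emeasurable_funB.
    - by have [] := integrableP _ _ _ (integrableB measurableT rfji lrfi).
    - apply: filterS aef => z fz _; rewrite fz//= -jE -EFinB -EFinM.
      by congr EFin; ring.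
  rewrite -EFin_Rintegral; last exact: (integrableB measurableT rfji lrfi).
  by rewrite RintegralB// RintegralZl// (Rintegral_density drf) mulr1.
(* Averaging [W] under [K z] and then over [f] is averaging it under [mix]. Tonelli is applied to
   the extended densities, and real parts are exchanged for them almost everywhere at both ends. *)
have tower : \int[mu]_z (rf z * j z) = \int[mu]_z (rmix z * W z).
  apply: EFin_inj; rewrite !EFin_Rintegral//.
  transitivity (\int[mu]_z (f z * J z))%E.
    apply: ae_eq_integral => //.
    - by have [] := integrableP _ _ _ rfji.
    - exact: emeasurable_funM.
    - by apply: filterS aef => z fz _; rewrite fz//= EFinM jE.
  transitivity (\int[mu]_zb (mix zb * (W zb)%:E))%E; last first.
    apply: ae_eq_integral => //.
    - apply: emeasurable_funM; last exact/measurable_EFinP.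
      exact: (measurable_density_kernel tt dmix).
    - by have [] := integrableP _ _ _ rmWi.
    - by apply: filterS aemix => z mz _; rewrite mz.
  transitivity (\int[mu]_z \int[mu]_zb (f z * (K z zb * (W zb)%:E)))%E.
    apply: eq_integral => z _; rewrite ge0_integralZl// => zb _.
    by rewrite mule_ge0// lee_fin.
  have := fubini_tonelli (m1 := mu) (m2 := mu)
    (fun w : Z * Z => f w.1 * (K w.1 w.2 * (W w.2)%:E))%E.
  move=> ->/=; last 2 first.
  - by apply: emeasurable_funM => //; exact: measurableT_comp.
  - by move=> w; rewrite !mule_ge0// lee_fin.
  apply: eq_integral => zb _; rewrite /mix -ge0_integralZr ?lee_fin//.
  - by apply: eq_integral => z _; rewrite muleA.
  - apply: emeasurable_funM => //; have [mK _ _] := dK.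
    by apply: (@measurableT_comp _ _ _ _ _ _ (fun z : Z * Z => K z.1 z.2) _
      (fun z => (z, zb))).
  - by move=> z _; rewrite mule_ge0.
have TVi : mu.-integrable setT (EFin \o (fun z => `|rf z - rmix z|)).
  apply: integrable_norm => //; exact: (integrableB measurableT rfi rmi).
have mixle : \int[mu]_z (rmix z * W z) <=
    \int[mu]_z (rf z * W z) + l * \int[mu]_z `|rf z - rmix z|.
  have i1 : mu.-integrable setT (EFin \o (fun z => l * rmix z)).
    exact: (integrableZl measurableT l rmi).
  have i2 : mu.-integrable setT (EFin \o (fun z => l * `|rf z - rmix z|)).
    exact: (integrableZl measurableT l TVi).
  have i3 : mu.-integrable setT (EFin \o (fun z => rf z * W z + l * rmix z)).
    exact: (integrableD measurableT rfWi i1).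
  have i4 : mu.-integrable setT (EFin \o (fun z =>
      rf z * W z + l * rmix z + l * `|rf z - rmix z|)).
    exact: (integrableD measurableT i3 i2).
  have i5 : mu.-integrable setT (EFin \o (fun z => rmix z * W z + l * rf z)).
    exact: (integrableD measurableT rmWi lrfi).
  (* Both sides carry an extra multiple of [l] that turns the pointwise claim into
     [(rf - rmix) G <= l |rf - rmix|]. The extra terms cancel after integration, both densities
     having mass 1. *)
  have : \int[mu]_z (rmix z * W z + l * rf z) <=
      \int[mu]_z (rf z * W z + l * rmix z + l * `|rf z - rmix z|).
    apply: le_Rintegral => // z _; rewrite /W.
    have : (rf z - rmix z) * G z <= l * `|rf z - rmix z|.
      by rewrite (le_trans (ler_norm _))// normrM mulrC ler_wpM2r.
    lra.
  rewrite RintegralD// RintegralD// RintegralD// !RintegralZl//.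
  by rewrite (Rintegral_density drf) (Rintegral_density drmix); lra.
apply: (@le_trans _ _ (\int[mu]_z (f z * (J z - l%:E)))%E).
  by apply: le_integral_pointwise => z; rewrite lee_wpmul2l.
rewrite fJE kl_marg tower.
apply: (@le_trans _ _ (\int[mu]_z (rf z * W z) - l +
    l * \int[mu]_z `|rf z - rmix z|)%:E).
  by rewrite lee_fin addrAC lerB.
rewrite EFinD leeD2l// EFinM lee_wpmul2l ?lee_fin//.
set V := \int[mu]_z `|_|.
have V0 : 0 <= V by exact: Rintegral_ge0.
(* Pinsker is applied to the real parts, whose KL divergence is at most that of the extended
   densities. *)
have Vle : ((V ^+ 2)%:E <= 2%:E * kl f mix)%E.
  apply: le_trans (pinsker drf drmix _) _ => [z|]; first by rewrite -rfX.
  rewrite lee_wpmul2l ?lee_fin//.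
  apply: le_integral_pointwise => z; apply: le_kl_integrand_fine => //.
  by rewrite -fX.
rewrite -[V%:E]gee0_abs ?lee_fin// -sqrte_sqr lee_sqrt ?EFin_expe//.
by apply: le_trans Vle; rewrite lee_fin sqr_ge0.
Qed.

End kl_mixture.

(** * Visitation distributions as density kernels *)

Section visitation_kernels.
Context {d1 d2 : measure_display} {S : measurableType d1}
  {A : measurableType d2} {R : realType}.
Variables (muS : {sigma_finite_measure set S -> \bar R})
          (muA : {sigma_finite_measure set A -> \bar R}).
Variables (pi : S -> A -> R) (p : S -> A -> S -> R) (gamma : R).
Hypothesis mp : measurable_fun setT (fun w : S * A * S => p w.1.1 w.1.2 w.2).
Hypothesis dp : forall s a, is_density muS (p s a).
Hypothesis mpi : measurable_fun setT (fun z : S * A => pi z.1 z.2).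
Hypothesis dpi : forall s, is_density muA (pi s).
Hypothesis gamma01 : 0 <= gamma < 1.

Lemma density_kernel_EFin {d d' : measure_display} {T : measurableType d}
    {U : measurableType d'} (mu : {measure set U -> \bar R}) (k : T -> U -> R) :
  measurable_fun setT (fun z : T * U => k z.1 z.2) ->
  (forall t, is_density mu (k t)) ->
  is_density_kernel mu (fun t u => (k t u)%:E).
Proof.
move=> mk dk; split=> [|t u|t]; first exact/measurable_EFinP.
- by rewrite lee_fin; have [_ [+ _]] := dk t; exact.
- by have [_ []] := dk t.
Qed.

(** One step of the process factors as drawing an action, a product with [pi], followed by
    composition with [p]. Both recursions, [ptrans] and [pmarg], have this shape. *)
Lemma density_kernel_step {d : measure_display} {T : measurableType d}
    (K : T -> S -> \bar R) : is_density_kernel muS K ->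
  is_density_kernel muS (fun t sb =>
    \int[muSA muS muA]_z (K t z.1 * (pi z.1 z.2 * p z.1 z.2 sb)%:E))%E.
Proof.
move=> dK.
have dp' : is_density_kernel muS (fun (z : S * A) sb => (p z.1 z.2 sb)%:E).
  exact: density_kernel_EFin.
have := density_kernel_comp (density_kernel_prod dK mpi dpi) dp'.
congr is_density_kernel; apply/funext => t; apply/funext => sb.
by apply: eq_integral => z _; rewrite EFinM muleA.
Qed.

Lemma density_kernel_ptrans n :
  is_density_kernel muS (fun z : S * A => ptrans muS muA pi p n z.1 z.2).
Proof.
by elim: n => [|n IHn]; [exact: density_kernel_EFin|exact: density_kernel_step IHn].
Qed.

Lemma density_kernel_pmarg p0 n : is_density muS p0 ->
  is_density_kernel muS (fun _ : unit => pmarg muS muA p0 pi p n).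
Proof.
move=> dp0; elim: n => [|n IHn]; last exact: density_kernel_step IHn.
apply: density_kernel_EFin => //.
by apply: (@measurableT_comp _ _ _ _ _ _ p0 _ snd) => //; have [] := dp0.
Qed.

(** Covers [dmarg] and [dcond] at once: a geometric mixture over time, then a product with the
    policy. *)
Lemma density_kernel_visitation {d : measure_display} {T : measurableType d}
    (K : nat -> T -> S -> \bar R) :
  (forall n, is_density_kernel muS (K n)) ->
  is_density_kernel (prod_sf muS muA) (fun t zb =>
    ((1 - gamma) * pi zb.1 zb.2)%:E *
    \sum_(0 <= n <oo) ((gamma ^+ n)%:E * K n t zb.1))%E.
Proof.
move=> dK.
have := density_kernel_prod (density_kernel_geometric gamma01 dK) mpi dpi.
congr is_density_kernel; apply/funext => t; apply/funext => zb.
by rewrite EFinM muleAC.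
Qed.

End visitation_kernels.

Theorem theorem1
  (d1 d2 : measure_display) (S : measurableType d1) (A : measurableType d2)
  (R : realType)
  (muS : {sigma_finite_measure set S -> \bar R})
  (muA : {sigma_finite_measure set A -> \bar R})
  (p0 : S -> R) (p : S -> A -> S -> R) (pi : S -> A -> R) (gamma : R)
  (qstar : S * A -> R) (X : set (S * A)) :
  (* MDP data: initial density, transition density, policy *)
  is_density muS p0 ->
  measurable_fun setT (fun w : S * A * S => p w.1.1 w.1.2 w.2) ->
  (forall s a, is_density muS (p s a)) ->
  measurable_fun setT (fun z : S * A => pi z.1 z.2) ->
  (forall s, is_density muA (pi s)) ->
  0 <= gamma < 1 ->
  (* q* is a probability density on S * A *)
  is_density (muSA muS muA) qstar ->
  (* common support X on which all four densities are strictly positive *)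
  measurable X ->
  (forall zb, (zb \in X) = (0 < dmarg muS muA p0 pi p gamma zb < +oo)%E) ->
  (forall zb, (zb \in X) = (0 < dtilde muS muA p0 pi p gamma zb < +oo)%E) ->
  (forall zb, (zb \in X) = (0 < qstar zb)) ->
  (forall z zb, (zb \in X) = (0 < dcond muS muA pi p gamma z zb < +oo)%E) ->
  let L := ereal_sup [set (`|ln (fine (dmarg muS muA p0 pi p gamma zb)
                                  / qstar zb)|)%:E | zb in X] in
  (L < +oo)%E ->
  (\int[muSA muS muA]_z (dmarg muS muA p0 pi p gamma z *
      - KL muS muA (dcond muS muA pi p gamma z) (fun zb => (qstar zb)%:E))
   <= - KL muS muA (dmarg muS muA p0 pi p gamma) (fun zb => (qstar zb)%:E)
      + L * sqrte (2%:E * KL muS muA (dmarg muS muA p0 pi p gamma)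
                                     (dtilde muS muA p0 pi p gamma)))%E.
Proof.
move=> dp0 mp dp mpi dpi gamma01 dq _ marginalX mixX qX condX L Loo.
have dmargK := density_kernel_visitation mpi dpi gamma01
  (fun n => density_kernel_pmarg mp dp mpi dpi n dp0).
have dcondK := density_kernel_visitation mpi dpi gamma01
  (fun n => density_kernel_ptrans mp dp mpi dpi n).
(* A supremum over an empty set would be [-oo], so [0 <= L] requires a point of [X]. One exists
   because [qstar] vanishes off [X] and has mass 1. *)
have [x0 x0X] : exists x, x \in X.
  apply: contrapT => /forallNP noX; have [_ [q0 q1]] := dq.
  have : (\int[muSA muS muA]_x (qstar x)%:E = 0)%E.
    apply: integral0_eq => z _; congr EFin; apply: le_anti.
    by rewrite q0 andbT leNgt -qX; exact/negP/noX.
  by rewrite q1 => /eqP; rewrite onee_eq0.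
have LX z : z \in X -> ((`|ln (fine (dmarg muS muA p0 pi p gamma z)
    / qstar z)|)%:E <= L)%E.
  by move=> zX; apply: ereal_sup_ubound; exists z => //; exact: set_mem.
have L0 : (0 <= L)%E by apply: le_trans (LX x0 x0X); rewrite lee_fin.
have Lfin : L \is a fin_num by rewrite ge0_fin_numE.
rewrite -[L]fineK//.
(* By definition [dtilde] is the mixture of the kernel [dcond] over [dmarg], and [prod_sf] unfolds
   to [muSA]. *)
apply: (kl_mixture_le dmargK dcondK dq marginalX mixX qX condX _ _).
- by move=> z zX; rewrite -lee_fin fineK//; exact: LX.
- exact: fine_ge0.
Qed.
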